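(* Let $F^{\bullet}$ be a chain complex of finitely-generated free $2$-parameter persistence modules over $k=\mathbb{Z}_2$. Any chain complex $\bar F^{\bullet}$ of finitely-generated free persistence modules quasi-isomorphic to $F^{\bullet}$ has to add at least $\delta^n_{\mathbf p}(F^\bullet)$ $n$-generators at grade $\mathbf p$; that is, for every $n\ge 0$ and every $\mathbf p\in\mathbb{Z}^2$, $$\delta_{\mathbf p}^n(F^{\bullet})\leq \gamma_{\mathbf p}^n(\bar{F}^{\bullet}).$$
   Context: **Persistence modules.** Let $k=\mathbb{Z}_2$ and let $\mathbb{Z}^2$ carry the product partial order. A ($2$-parameter) persistence module is a functor $M:\mathbb{Z}^2\to \mathrm{Vec}_k$; homomorphisms are natural transformations; kernels, cokernels and direct sums are pointwise. For $\mathbf u\in\mathbb{Z}^2$, $E^{\mathbf u}$ is the module with $E^{\mathbf u}_{\mathbf z}=k$ if $\mathbf u\le \mathbf z$ and $0$ otherwise, with identity maps between nonzero spaces. A module is free if it is isomorphic to a direct sum of modules $E^{\mathbf u}$. **Chain complexes.** A chain complex $F^\bullet$ of free persistence modules is a diagram $\cdots\xrightarrow{\partial^2}F^1\xrightarrow{\partial^1}F^0$ of free modules with $\partial^i\circ\partial^{i+1}=0$ (put $\partial^0=0$). Its homology is the persistence module $H^n(F^\bullet)=\operatorname{Ker}\partial^n/\operatorname{Im}\partial^{n+1}$. $F^\bullet$ and $\bar F^\bullet$ are quasi-isomorphic if there is a chain map $f:F^\bullet\to\bar F^\bullet$ such that all induced maps $f^n_*:H^n(F^\bullet)\to H^n(\bar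 F^\bullet)$ are isomorphisms. **The quantities $\delta$ and $\gamma$.** Let $\bar F^\bullet$ be a chain complex of finitely generated free persistence modules and $\mathbf p=(p_x,p_y)\in\mathbb{Z}^2$. Let $\bar F^n_{<\mathbf p}$ be the colimit of the restriction of $\bar F^n$ to the subposet $\{\mathbf z\in\mathbb{Z}^2:\mathbf z<\mathbf p\}$ (i.e. $\mathbf z\le\mathbf p$, $\mathbf z\ne\mathbf p$). Equivalently, with $\mathbf p_0=(p_x-1,p_y-1)$, $\mathbf p_1=(p_x-1,p_y)$, $\mathbf p_2=(p_x,p_y-1)$, it is defined by the short exact sequence $0\to \bar F^n_{\mathbf p_0}\to \bar F^n_{\mathbf p_1}\oplus\bar F^n_{\mathbf p_2}\to\bar F^n_{<\mathbf p}\to 0$. With the induced boundary maps $\bar F^\bullet_{<\mathbf p}$ is a chain complex of vector spaces, included in $\bar F^\bullet_{\mathbf p}$. Let $\eta^n_{\mathbf p}:H^n(\bar F^\bullet_{<\mathbf p})\to H^n(\bar F^\bullet_{\mathbf p})$ be the map in $n$-th homology induced by the inclusion (homology in degree $-1$ is $0$). Define $$\delta^n_{\mathbf p}(\bar F^\bullet)=\dim\operatorname{Ker}\eta^{n-1}_{\mathbf p}+\dim\operatorname{Coker}\eta^n_{\mathbf p},\qquad \gamma^n_{\mathbf p}(\bar F^\bullet)=\dim\bar F^n_{\mathbf p}-\dim\bar F^n_{<\mathbf p}.$$ The number $\gamma^n_{\mathbf p}(\bar F^\bullet)$ is what is meant by the number of $n$-generators that $\bar F^\bullet$ adds at grade $\mathbf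 p$. The same definitions apply to $F^\bullet$. *)

(* Defs.v *)
From HB Require Import structures.
From mathcomp Require Import all_boot all_order all_algebra.
From mathcomp Require Import generic_quotient ring_quotient.
From mathcomp Require Import boolp classical_sets.

Set Implicit Arguments.
Unset Strict Implicit.
Unset Printing Implicit Defensive.

Import Order.TTheory GRing.Theory Num.Theory.
Local Open Scope ring_scope.
Local Open Scope quotient_scope.

Section Kernel.
Variables (K : fieldType) (V W : lmodType K) (f : {linear V -> W}).

Definition ker_pred : {pred V} := [pred x | f x == 0].

Lemma ker_pred_submod : submod_closed ker_pred.
Proof.
split; first by rewrite inE linear0.
by move=> a x y; rewrite !inE linearP => /eqP-> /eqP->; rewrite scaler0 addr0.
Qed.

HB.instance Definition _ :=
  GRing.isSubmodClosed.Build K V ker_pred ker_pred_submod.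

Record ker := Ker { ker_val :> V; ker_valP : ker_val \in ker_pred }.

HB.instance Definition _ := [isSub for ker_val].
HB.instance Definition _ := [Choice of ker by <:].
HB.instance Definition _ := [SubChoice_isSubZmodule of ker by <:].
HB.instance Definition _ := [SubZmodule_isSubLmodule of ker by <:].

Lemma ker_valE (x : ker) : f (\val x) = 0.
Proof. by case: x => x /= /eqP. Qed.

End Kernel.

Section KernelLift.
Variables (K : fieldType) (U V W : lmodType K).
Variables (f : {linear V -> W}) (h : {linear U -> V}).
Hypothesis fh : forall x, f (h x) = 0.

Fact ker_lift_subproof x : h x \in ker_pred f.
Proof. by rewrite inE fh. Qed.

Definition ker_lift (x : U) : ker f := Ker (ker_lift_subproof x).

Fact ker_lift_linear : linear ker_lift.
Proof. by move=> a x y; apply: val_inj; rewrite /= linearP. Qed.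

HB.instance Definition _ :=
  GRing.isLinear.Build K U (ker f) *:%R ker_lift ker_lift_linear.

End KernelLift.

Section Cokernel.
Variables (K : fieldType) (V W : lmodType K) (f : {linear V -> W}).

Definition im_pred : {pred W} := [pred y | `[< exists x, f x = y >]].

Lemma im_predP y : reflect (exists x, f x = y) (y \in im_pred).
Proof. exact: asboolP. Qed.

Lemma im_pred_submod : submod_closed im_pred.
Proof.
split; first by apply/im_predP; exists 0; rewrite linear0.
move=> a _ _ /im_predP[x <-] /im_predP[y <-]; apply/im_predP.
by exists (a *: x + y); rewrite linearP.
Qed.

HB.instance Definition _ :=
  GRing.isSubmodClosed.Build K W im_pred im_pred_submod.

Definition coker := Quotient.quot im_pred.

HB.instance Definition _ := GRing.Zmodule.on coker.

Definition coker_pi (y : W) : coker := \pi_coker y.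

Lemma coker_eq y z : (coker_pi y = coker_pi z) <-> exists x, f x = y - z.
Proof.
rewrite /coker_pi; split.
  by move=> /eqP; rewrite -Quotient.idealrBE => /im_predP.
by move=> h; apply/eqP; rewrite -Quotient.idealrBE; apply/im_predP.
Qed.

Lemma coker_piD y z : coker_pi (y + z) = coker_pi y + coker_pi z.
Proof. by rewrite /coker_pi piE. Qed.

Lemma coker_pi_surj (q : coker) : exists y, coker_pi y = q.
Proof. by exists (repr q); rewrite /coker_pi reprK. Qed.

Definition coker_scale (a : K) (q : coker) : coker := coker_pi (a *: repr q).

Lemma coker_piZ a y : coker_pi (a *: y) = coker_scale a (coker_pi y).
Proof.
apply/coker_eq; have /coker_eq[x fx] : coker_pi y = coker_pi (repr (coker_pi y)).
  by rewrite /coker_pi reprK.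
by exists (a *: x); rewrite linearZ /= fx scalerBr.
Qed.

Fact coker_scaleA a b q :
  coker_scale a (coker_scale b q) = coker_scale (a * b) q.
Proof.
by have [y <-] := coker_pi_surj q; rewrite -!coker_piZ scalerA.
Qed.

Fact coker_scale1 : left_id 1 coker_scale.
Proof. by move=> q; have [y <-] := coker_pi_surj q; rewrite -coker_piZ scale1r. Qed.

Fact coker_scaleDr : right_distributive coker_scale +%R.
Proof.
move=> a q r; have [y <-] := coker_pi_surj q; have [z <-] := coker_pi_surj r.
by rewrite -!(coker_piD, coker_piZ) scalerDr.
Qed.

Fact coker_scaleDl q : {morph coker_scale^~ q : a b / a + b}.
Proof.
move=> a b; have [y <-] := coker_pi_surj q.
by rewrite -!coker_piZ -coker_piD scalerDl.
Qed.

HB.instance Definition _ := GRing.Zmodule_isLmodule.Build K coker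
  coker_scaleA coker_scale1 coker_scaleDr coker_scaleDl.

Fact coker_pi_linear : linear coker_pi.
Proof. by move=> a x y; rewrite coker_piD coker_piZ. Qed.

HB.instance Definition _ :=
  GRing.isLinear.Build K W coker *:%R coker_pi coker_pi_linear.

End Cokernel.

Section CokernelDesc.
Variables (K : fieldType) (V W X : lmodType K).
Variables (f : {linear V -> W}) (h : {linear W -> X}).

Definition coker_desc (hf : forall x, h (f x) = 0) (q : coker f) : X :=
  h (repr q).

Hypothesis hf : forall x, h (f x) = 0.

Lemma coker_descE y : coker_desc hf (coker_pi f y) = h y.
Proof.
rewrite /coker_desc; apply/eqP; rewrite -subr_eq0 -linearB.
have /coker_eq[x <-] : coker_pi f (repr (coker_pi f y)) = coker_pi f y.
  by rewrite /coker_pi reprK.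
by rewrite hf.
Qed.

Fact coker_desc_linear : linear (coker_desc hf).
Proof.
move=> a q r; have [y <-] := coker_pi_surj q; have [z <-] := coker_pi_surj r.
by rewrite -linearP !coker_descE linearP.
Qed.

HB.instance Definition _ :=
  GRing.isLinear.Build K (coker f) X *:%R (coker_desc hf) coker_desc_linear.

End CokernelDesc.

(* Junk value 0 when V is not finite-dimensional. *)
Definition dimension (K : fieldType) (V : lmodType K) : nat :=
  xget 0%N [set n | exists g : {linear 'rV[K]_n -> V}, bijective g].

Lemma dimensionE (K : fieldType) (V : lmodType K) n
    (g : {linear 'rV[K]_n -> V}) : bijective g -> dimension V = n.
Proof.
move=> gbij; apply: xget_unique; first by exists g.
suff le m p (a : {linear 'rV[K]_m -> V}) (b : {linear 'rV[K]_p -> V}) :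
    bijective a -> bijective b -> (m <= p)%N.
  by move=> m [h hbij]; apply/eqP; rewrite eqn_leq (le _ _ h g) ?(le _ _ g h).
move=> [a' aK _] [b' bK b'K].
have lin : linear (b' \o a).
  by move=> c x y; apply: (can_inj bK); rewrite /= b'K !linearP /= !b'K.
pose L := GRing.isLinear.Build _ _ _ _ _ lin.
pose c : {linear 'rV[K]_m -> 'rV[K]_p} := HB.pack (b' \o a) L.
have cinj : injective c by apply: (can_inj (g := a' \o b)) => x /=; rewrite b'K aK.
have : row_free (lin1_mx c).
  rewrite -kermx_eq0; apply/eqP/row_matrixP => i; apply: cinj.
  rewrite row0 linear0 -mul_rV_lin1.
  by have /sub_kermxP := row_sub i (kermx (lin1_mx c)).
by rewrite /row_free => /eqP <-; exact: rank_leq_col.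
Qed.

Record vcomplex (K : fieldType) := VComplex {
  vc_space :> nat -> lmodType K;
  vc_d : forall n, {linear vc_space n.+1 -> vc_space n};
  vc_dd : forall n x, vc_d n (vc_d n.+1 x) = 0 }.

Record vchain (K : fieldType) (C D : vcomplex K) := VChain {
  vch_fun :> forall n, {linear C n -> D n};
  vch_comm : forall n x, vch_fun n (vc_d C n x) = vc_d D n (vch_fun n.+1 x) }.

Section VHomology.
Variable K : fieldType.

Definition vc_prev (C : vcomplex K) (n : nat) : lmodType K :=
  if n is m.+1 then C m else 'rV[K]_0.

(* The differential leaving degree n, which is 0 for n = 0. *)
Definition vc_bd (C : vcomplex K) (n : nat) : {linear C n -> vc_prev C n} :=
  match n return {linear C n -> vc_prev C n} with
  | 0 => \0
  | m.+1 => vc_d C m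
  end.

Lemma vc_bd_d (C : vcomplex K) n x : vc_bd C n (vc_d C n x) = 0.
Proof. by case: n x => [|n] x //=; rewrite vc_dd. Qed.

Definition vc_cycles (C : vcomplex K) n : lmodType K := ker (vc_bd C n).

Definition vc_boundary (C : vcomplex K) n : {linear C n.+1 -> vc_cycles C n} :=
  ker_lift (@vc_bd_d C n).

Definition vH (C : vcomplex K) (n : nat) : lmodType K := coker (vc_boundary C n).

Section Map.
Variables (C D : vcomplex K) (f : vchain C D) (n : nat).

Lemma vcycles_map_subproof (x : vc_cycles C n) :
  vc_bd D n ((f n \o (\val : vc_cycles C n -> C n)) x) = 0.
Proof.
case: n x => [|m] [x /= /eqP xP] //=; by rewrite -vch_comm xP linear0.
Qed.

Definition vcycles_map : {linear vc_cycles C n -> vc_cycles D n} :=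
  ker_lift vcycles_map_subproof.

Lemma vH_map_subproof (x : C n.+1) :
  (coker_pi (vc_boundary D n) \o vcycles_map) (vc_boundary C n x) = 0.
Proof.
rewrite /= -(linear0 (coker_pi (vc_boundary D n))); apply/coker_eq.
by exists (f n.+1 x); rewrite subr0; apply: val_inj; rewrite /= vch_comm.
Qed.

Definition vH_map : {linear vH C n -> vH D n} := coker_desc vH_map_subproof.

Lemma vH_mapE (x : vc_cycles C n) :
  vH_map (coker_pi _ x) = coker_pi _ (vcycles_map x).
Proof. exact: coker_descE. Qed.

End Map.

Lemma vH_map_id (C : vcomplex K) (f : vchain C C) n :
  (forall x, f n x = x) -> forall q, vH_map f n q = q.
Proof.
move=> fE q; have [x <-] := coker_pi_surj q; rewrite vH_mapE; congr coker_pi.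
by apply: val_inj; rewrite /= fE.
Qed.

Lemma vH_map_square (C D D' E : vcomplex K) (f : vchain C D) (g : vchain D E)
    (f' : vchain C D') (g' : vchain D' E) n :
  (forall x, g n (f n x) = g' n (f' n x)) ->
  forall q, vH_map g n (vH_map f n q) = vH_map g' n (vH_map f' n q).
Proof.
move=> E_ q; have [x <-] := coker_pi_surj q; rewrite !vH_mapE; congr coker_pi.
by apply: val_inj; rewrite /= E_.
Qed.

Lemma vH_map_comp (C D E : vcomplex K) (f : vchain C D) (g : vchain D E)
    (h : vchain C E) n :
  (forall x, g n (f n x) = h n x) ->
  forall q, vH_map g n (vH_map f n q) = vH_map h n q.
Proof.
move=> E_ q; have [x <-] := coker_pi_surj q; rewrite !vH_mapE; congr coker_pi.
by apply: val_inj; rewrite /= E_.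
Qed.

End VHomology.

(* [int *p int] carries the product (componentwise) order. *)
Notation grade := (int *p int)%type.

Record pmod (K : fieldType) := PMod {
  pm_space :> grade -> lmodType K;
  pm_map : forall u v : grade,
    (u <= v)%O -> {linear pm_space u -> pm_space v};
  pm_map_id : forall u (uu : (u <= u)%O) x, pm_map uu x = x;
  pm_map_comp : forall u v w (uv : (u <= v)%O) (vw : (v <= w)%O)
    (uw : (u <= w)%O) x, pm_map vw (pm_map uv x) = pm_map uw x }.

Record phom (K : fieldType) (M N : pmod K) := PHom {
  ph_fun :> forall z, {linear M z -> N z};
  ph_nat : forall u v (uv : (u <= v)%O) x,
    ph_fun v (pm_map M uv x) = pm_map N uv (ph_fun u x) }.

Definition is_piso (K : fieldType) (M N : pmod K) (f : phom M N) : Prop :=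
  exists g : phom N M,
    (forall z x, g z (f z x) = x) /\ (forall z y, f z (g z y) = y).

Definition pisomorphic (K : fieldType) (M N : pmod K) : Prop :=
  exists f : phom M N, is_piso f.

Section FreeModules.
Variable K : fieldType.

Section Elementary.
Variable u : grade.

(* The boolean [u <= z] is coerced to a dimension in {0, 1}. *)
Definition E_space (z : grade) : lmodType K := 'rV[K]_(u <= z)%O.

(* Between two one-dimensional spaces [const_mx 1] is the 1 x 1 identity. *)
Definition E_map (z w : grade) (_ : (z <= w)%O) :
    {linear E_space z -> E_space w} :=
  mulmxr (const_mx 1 : 'M[K]_((u <= z)%O, (u <= w)%O)).

Lemma E_map_id z (zz : (z <= z)%O) x : E_map zz x = x.
Proof.
rewrite /E_map /E_space /= in x *; case: (u <= z)%O x => x; last by apply/matrixP => i [].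
by rewrite -[RHS]mulmx1; congr mulmx; apply/matrixP => i j; rewrite !mxE !ord1.
Qed.

Lemma E_map_comp z w t (zw : (z <= w)%O) (wt : (w <= t)%O) (zt : (z <= t)%O) x :
  E_map wt (E_map zw x) = E_map zt x.
Proof.
rewrite /E_map /E_space /= in x *.
have := fun h => le_trans (h : (u <= z)%O) zw.
case: (u <= z)%O x => x; last first.
  by have -> : x = 0 by [apply/matrixP => i []]; rewrite !mul0mx.
move=> ->//; rewrite -mulmxA; congr mulmx; apply/matrixP => i j.
by rewrite !mxE big_ord1 !mxE mulr1.
Qed.

Definition E_mod : pmod K := PMod E_map_id E_map_comp.

End Elementary.

Definition pzero : pmod K :=
  @PMod K (fun=> 'rV[K]_0) (fun _ _ _ => idfun)
    (fun _ _ _ => erefl) (fun _ _ _ _ _ _ _ => erefl).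

Section PairMap.
Variables (V V' W W' : lmodType K).
Variables (f : {linear V -> W}) (g : {linear V' -> W'}).

Definition pair_map (x : V * V') : W * W' := (f x.1, g x.2).

Fact pair_map_linear : linear pair_map.
Proof. by move=> a x y; rewrite /pair_map /= !linearP. Qed.

HB.instance Definition _ :=
  GRing.isLinear.Build K (V * V')%type (W * W')%type *:%R pair_map pair_map_linear.
End PairMap.

Section DirectSum.
Variables M N : pmod K.

Definition psum_space (z : grade) : lmodType K := (M z * N z)%type.

Definition psum_map (u v : grade) (uv : (u <= v)%O) :
    {linear psum_space u -> psum_space v} :=
  pair_map (pm_map M uv) (pm_map N uv).

Lemma psum_map_id u (uu : (u <= u)%O) x : psum_map uu x = x.
Proof. by case: x => x y; rewrite /psum_map /= /pair_map !pm_map_id. Qed.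

Lemma psum_map_comp u v w (uv : (u <= v)%O) (vw : (v <= w)%O) (uw : (u <= w)%O) x :
  psum_map vw (psum_map uv x) = psum_map uw x.
Proof.
by rewrite /psum_map /= /pair_map /= (pm_map_comp uv vw uw)
  (pm_map_comp uv vw uw).
Qed.

Definition psum : pmod K := PMod psum_map_id psum_map_comp.
End DirectSum.

Definition pfree_on (s : seq grade) : pmod K :=
  foldr (fun u M => psum (E_mod u) M) pzero s.

Definition fg_free (M : pmod K) : Prop :=
  exists s : seq grade, pisomorphic M (pfree_on s).

End FreeModules.

Record pcomplex (K : fieldType) := PComplex {
  pc_mod :> nat -> pmod K;
  pc_d : forall n, phom (pc_mod n.+1) (pc_mod n);
  pc_dd : forall n z x, pc_d n z (pc_d n.+1 z x) = 0 }.

Record pchain (K : fieldType) (C D : pcomplex K) := PChain {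
  pch_fun :> forall n, phom (C n) (D n);
  pch_comm : forall n z x,
    pch_fun n z (pc_d C n z x) = pc_d D n z (pch_fun n.+1 z x) }.

Section PHomology.
Variable K : fieldType.

Definition pc_at (C : pcomplex K) (z : grade) : vcomplex K :=
  @VComplex K (fun n => C n z) (fun n => pc_d C n z)
    (fun n => @pc_dd K C n z).

Definition pc_shift (C : pcomplex K) (u v : grade) (uv : (u <= v)%O) :
    vchain (pc_at C u) (pc_at C v) :=
  @VChain K (pc_at C u) (pc_at C v) (fun n => pm_map (C n) uv)
    (fun n x => esym (ph_nat (pc_d C n) uv x)).

Section Homology.
Variables (C : pcomplex K) (n : nat).

Definition pH_map (u v : grade) (uv : (u <= v)%O) :
    {linear vH (pc_at C u) n -> vH (pc_at C v) n} :=
  vH_map (pc_shift C uv) n.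

Lemma pH_map_id u (uu : (u <= u)%O) q : pH_map uu q = q.
Proof. by apply: vH_map_id => x /=; exact: pm_map_id. Qed.

Lemma pH_map_comp u v w (uv : (u <= v)%O) (vw : (v <= w)%O) (uw : (u <= w)%O) q :
  pH_map vw (pH_map uv q) = pH_map uw q.
Proof. by apply: vH_map_comp => x /=; exact: pm_map_comp. Qed.

Definition pH : pmod K := PMod pH_map_id pH_map_comp.
End Homology.

Section Induced.
Variables (C D : pcomplex K) (f : pchain C D).

Definition pch_at (z : grade) : vchain (pc_at C z) (pc_at D z) :=
  @VChain K (pc_at C z) (pc_at D z) (fun n => f n z)
    (fun n => @pch_comm K C D f n z).

Lemma pH_induced_nat n u v (uv : (u <= v)%O) (q : pH C n u) :
  vH_map (pch_at v) n (pm_map (pH C n) uv q)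
    = pm_map (pH D n) uv (vH_map (pch_at u) n q).
Proof. by apply: vH_map_square => x /=; exact: ph_nat. Qed.

Definition pH_induced n : phom (pH C n) (pH D n) :=
  @PHom K (pH C n) (pH D n) (fun z => vH_map (pch_at z) n) (@pH_induced_nat n).
End Induced.

Definition quasi_isomorphic (C D : pcomplex K) : Prop :=
  exists f : pchain C D, forall n, is_piso (pH_induced f n).

End PHomology.

Definition grade0 (p : grade) : grade := (p.1 - 1, p.2 - 1).
Definition grade1 (p : grade) : grade := (p.1 - 1, p.2).
Definition grade2 (p : grade) : grade := (p.1, p.2 - 1).

Lemma grade_le (a b c d : int) :
  (((a, b) : grade) <= ((c, d) : grade))%O = (a <= c) && (b <= d).
Proof. by []. Qed.

Lemma le_grade01 p : (grade0 p <= grade1 p)%O.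
Proof. by rewrite grade_le lexx gerBl. Qed.
Lemma le_grade02 p : (grade0 p <= grade2 p)%O.
Proof. by rewrite grade_le lexx gerBl. Qed.
Lemma le_grade1 (p : grade) : (grade1 p <= p)%O.
Proof. by case: p => a b; rewrite grade_le lexx gerBl. Qed.
Lemma le_grade2 (p : grade) : (grade2 p <= p)%O.
Proof. by case: p => a b; rewrite grade_le lexx gerBl. Qed.

Lemma le_grade1E (z p : grade) : (z <= grade1 p)%O = (z.1 < p.1) && (z.2 <= p.2).
Proof. by case: z => a b; rewrite grade_le lerBrDr lezD1. Qed.
Lemma le_grade2E (z p : grade) : (z <= grade2 p)%O = (z.1 <= p.1) && (z.2 < p.2).
Proof. by case: z => a b; rewrite grade_le lerBrDr lezD1. Qed.
Lemma le_grade0E (z p : grade) : (z <= grade0 p)%O = (z.1 < p.1) && (z.2 < p.2).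
Proof. by case: z => a b; rewrite grade_le !lerBrDr !lezD1. Qed.

Lemma lt_grade (z p : grade) :
  (z < p)%O = (z <= grade1 p)%O || (z <= grade2 p)%O.
Proof.
rewrite le_grade1E le_grade2E lt_neqAle; case: z p => [a b] [c d].
rewrite grade_le xpair_eqE /= !lt_neqAle.
by case: (a == c); case: (b == d); case: (a <= c)%R; case: (b <= d)%R.
Qed.

Section Below.
Variable K : fieldType.

Section Glue.
Variables (M : pmod K) (p : grade).

Definition glue (x : M (grade0 p)) : M (grade1 p) * M (grade2 p) :=
  (pm_map M (le_grade01 p) x, - pm_map M (le_grade02 p) x).

Fact glue_linear : linear glue.
Proof.
by move=> a x y; rewrite /glue !linearP.
Qed.

HB.instance Definition _ :=
  GRing.isLinear.Build K (M (grade0 p)) (M (grade1 p) * M (grade2 p))%type *:%R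
    glue glue_linear.

(* The colimit of M over {z < p}, presented as a cokernel; its universal
   property is [below_in_cocone] and [below_colimit]. *)
Definition below : lmodType K := coker glue.

Definition unglue (x : M (grade1 p) * M (grade2 p)) : M p :=
  pm_map M (le_grade1 p) x.1 + pm_map M (le_grade2 p) x.2.

Fact unglue_linear : linear unglue.
Proof. by move=> a x y; rewrite /unglue /= !linearP scalerDr addrACA. Qed.

HB.instance Definition _ :=
  GRing.isLinear.Build K (M (grade1 p) * M (grade2 p))%type (M p) *:%R
    unglue unglue_linear.

Lemma unglue_glue x : unglue (glue x) = 0.
Proof.
have h : (grade0 p <= p)%O := le_trans (le_grade01 p) (le_grade1 p).
by rewrite /unglue /= linearN (pm_map_comp _ _ h) (pm_map_comp _ _ h) subrr.
Qed.

Definition below_incl : {linear below -> M p} := coker_desc unglue_glue.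

Lemma below_inclE x : below_incl (coker_pi glue x) = unglue x.
Proof. exact: coker_descE. Qed.

End Glue.

Arguments glue M p x : clear implicits.
Arguments unglue M p x : clear implicits.

Section BelowColimit.
Variables (M : pmod K) (p : grade).

Definition below_cocone (L : lmodType K)
    (i : forall z : grade, (z < p)%O -> {linear M z -> L}) : Prop :=
  forall z w (zp : (z < p)%O) (wp : (w < p)%O) (zw : (z <= w)%O) x,
    i w wp (pm_map M zw x) = i z zp x.

Definition below_pre (z : grade) (x : M z) : M (grade1 p) * M (grade2 p) :=
  match boolP (z <= grade1 p)%O with
  | AltTrue h => (pm_map M h x, 0)
  | AltFalse _ =>
    match boolP (z <= grade2 p)%O with
    | AltTrue h => (0, pm_map M h x)
    | AltFalse _ => 0
    end
  end.

Fact below_pre_linear z : linear (@below_pre z).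
Proof.
move=> a x y; rewrite /below_pre; case: {-}_ / boolP => h1.
  by rewrite linearP; congr pair; rewrite /= scaler0 addr0.
case: {-}_ / boolP => h2; last by rewrite scaler0 addr0.
by rewrite linearP; congr pair; rewrite /= scaler0 addr0.
Qed.

HB.instance Definition _ z :=
  GRing.isLinear.Build K (M z) (M (grade1 p) * M (grade2 p))%type *:%R
    (@below_pre z) (@below_pre_linear z).

Definition below_in (z : grade) : {linear M z -> below M p} :=
  coker_pi (glue M p) \o @below_pre z.

Lemma below_in1 z (h : (z <= grade1 p)%O) x :
  below_in z x = coker_pi (glue M p) (pm_map M h x, 0).
Proof.
rewrite /below_in /= /below_pre; case: {-}_ / boolP => [h1|]; last by rewrite h.
by rewrite (bool_irrelevance h1 h).
Qed.

Lemma below_in2 z (h : (z <= grade2 p)%O) x :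
  below_in z x = coker_pi (glue M p) (0, pm_map M h x).
Proof.
rewrite /below_in /= /below_pre; case: {-}_ / boolP => h1.
  have h0 : (z <= grade0 p)%O.
    move: h h1; rewrite le_grade0E le_grade1E le_grade2E.
    by move=> /andP[_ ->] /andP[-> _].
  apply/coker_eq; exists (pm_map M h0 x).
  rewrite /= /glue (pm_map_comp _ _ h1) (pm_map_comp _ _ h).
  by congr pair; rewrite /= ?subr0 ?sub0r.
case: {-}_ / boolP => [h2|]; last by rewrite h.
by rewrite (bool_irrelevance h2 h).
Qed.

Lemma below_in_cocone : below_cocone (fun z _ => below_in z).
Proof.
move=> z w _; rewrite lt_grade => /orP[] h zw x; have h' := le_trans zw h.
  by rewrite (below_in1 h) (below_in1 h') (pm_map_comp _ _ h').
by rewrite (below_in2 h) (below_in2 h') (pm_map_comp _ _ h').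
Qed.

Lemma below_incl_in z (zp : (z < p)%O) (zp' : (z <= p)%O) x :
  below_incl M p (below_in z x) = pm_map M zp' x.
Proof.
have := zp; rewrite lt_grade => /orP[] h.
  rewrite (below_in1 h) below_inclE /unglue /= linear0 addr0.
  exact: pm_map_comp.
rewrite (below_in2 h) below_inclE /unglue /= linear0 add0r.
exact: pm_map_comp.
Qed.

Lemma below_colimit (L : lmodType K)
    (g : forall z : grade, (z < p)%O -> {linear M z -> L}) :
  below_cocone g ->
  exists h : {linear below M p -> L},
    (forall z (zp : (z < p)%O) x, h (below_in z x) = g z zp x) /\
    (forall h' : {linear below M p -> L},
      (forall z (zp : (z < p)%O) x, h' (below_in z x) = g z zp x) -> h' =1 h).
Proof.
move=> gC.
have p1 : (grade1 p < p)%O by rewrite lt_grade lexx.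
have p2 : (grade2 p < p)%O by rewrite lt_grade lexx orbT.
have p0 : (grade0 p < p)%O by rewrite lt_grade le_grade01.
pose k (x : M (grade1 p) * M (grade2 p)) := g _ p1 x.1 + g _ p2 x.2.
have kL : linear k.
  by move=> a x y; rewrite /k /= !linearP scalerDr addrACA.
pose L' := GRing.isLinear.Build _ _ _ _ _ kL.
pose k' : {linear (M (grade1 p) * M (grade2 p))%type -> L} := HB.pack k L'.
have kg x : k' (glue M p x) = 0.
  rewrite /= /k /= linearN (gC _ _ p0 p1 (le_grade01 p)).
  by rewrite (gC _ _ p0 p2 (le_grade02 p)) subrr.
have hE (h' : {linear below M p -> L}) :
    (forall z (zp : (z < p)%O) x, h' (below_in z x) = g z zp x) ->
    forall x y, h' (coker_pi (glue M p) (x, y)) = k (x, y).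
  move=> h'E x y; rewrite /k /= -!h'E.
  rewrite (below_in1 (lexx _)) (below_in2 (lexx _)) !pm_map_id -!linearD.
  by congr (h' (coker_pi _ (_, _))); rewrite /= ?addr0 ?add0r.
have descE x : coker_desc kg (coker_pi (glue M p) x) = k x.
  exact: (coker_descE kg).
exists (coker_desc kg); split.
  move=> z zp x; have := zp; rewrite lt_grade => /orP[] h.
    rewrite (below_in1 h); apply: (etrans (descE _)).
    by rewrite /k /= linear0 addr0 (gC _ _ zp).
  rewrite (below_in2 h); apply: (etrans (descE _)).
  by rewrite /k /= linear0 add0r (gC _ _ zp).
move=> h' /hE h'E q; have [[x y] <-] := coker_pi_surj q.
by rewrite h'E; apply/esym/descE.
Qed.

End BelowColimit.

Section BelowMap.
Variables (M N : pmod K) (f : phom M N) (p : grade).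

Lemma below_map_subproof x :
  (coker_pi (glue N p) \o pair_map (f (grade1 p)) (f (grade2 p))) (glue M p x) = 0.
Proof.
rewrite /= -(linear0 (coker_pi (glue N p))); apply/coker_eq.
by exists (f _ x); rewrite subr0 /pair_map /glue /= linearN !ph_nat.
Qed.

Definition below_map : {linear below M p -> below N p} :=
  coker_desc below_map_subproof.

Lemma below_mapE x :
  below_map (coker_pi _ x) = coker_pi _ (pair_map (f (grade1 p)) (f (grade2 p)) x).
Proof. exact: coker_descE. Qed.

Lemma below_incl_nat q : below_incl N p (below_map q) = f p (below_incl M p q).
Proof.
have [[x y] <-] := coker_pi_surj q.
by rewrite below_mapE !below_inclE /unglue /pair_map /= linearD !ph_nat.
Qed.
End BelowMap.

Section BelowComplex.
Variables (C : pcomplex K) (p : grade).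

Lemma below_dd n q : below_map (pc_d C n) p (below_map (pc_d C n.+1) p q) = 0.
Proof.
have [[x y] <-] := coker_pi_surj q; rewrite !below_mapE /pair_map /= !pc_dd.
exact: (linear0 (coker_pi (glue (C n) p))).
Qed.

Definition pc_below : vcomplex K :=
  @VComplex K (fun n => below (C n) p) (fun n => below_map (pc_d C n) p) below_dd.

Definition pc_below_incl : vchain pc_below (pc_at C p) :=
  @VChain K pc_below (pc_at C p) (fun n => below_incl (C n) p)
    (fun n => @below_incl_nat _ _ (pc_d C n) p).

Definition eta (n : nat) : {linear vH pc_below n -> vH (pc_at C p) n} :=
  vH_map pc_below_incl n.

End BelowComplex.

Definition delta (n : nat) (p : grade) (C : pcomplex K) : nat :=
  ((if n is m.+1 then dimension (ker (eta C p m)) else 0)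
   + dimension (coker (eta C p n)))%N.

(* Valued in [int] because subtraction on [nat] truncates. *)
Definition gamma (n : nat) (p : grade) (C : pcomplex K) : int :=
  (dimension (C n p))%:Z - (dimension (below (C n) p))%:Z.

End Below.

(* Main.v *)
(* A quasi-isomorphism F -> Fbar has a pointwise acyclic mapping cone.  Since
   freeness makes 0 -> M_p0 -> M_p1 + M_p2 -> M_<p -> 0 exact, the cone of
   F_<p -> Fbar_<p is acyclic too.  Hence every class in Ker eta^(n-1) of F is
   represented by some y in Fbar^n_p with d y in Fbar_<p, and every class in
   Coker eta^n of F by a cycle in Fbar^n_p; lifting bases of these two spaces
   gives vectors of Fbar^n_p which are linearly independent of each other and of
   the image of Fbar^n_<p. *)
From HB Require Import structures.
Require Import Defs.
From mathcomp Require Import all_boot all_order all_algebra.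
From mathcomp Require Import boolp zify.

Set Implicit Arguments.
Unset Strict Implicit.
Unset Printing Implicit Defensive.

Import Order.TTheory GRing.Theory Num.Theory.
Local Open Scope ring_scope.

(** * Finite dimension, independent families and linear relations *)

Section FiniteDimension.
Variable K : fieldType.

(** This is the condition under which [dimension] returns the true dimension and not its default
    0. *)
Definition findim (V : lmodType K) : Prop :=
  exists n (g : {linear 'rV[K]_n -> V}), bijective g.

Lemma linear_injective (V W : lmodType K) (g : {linear V -> W}) :
  (forall x, g x = 0 -> x = 0) -> injective g.
Proof.
move=> g0 x y gxy; apply/eqP; rewrite -subr_eq0; apply/eqP/g0.
by rewrite linearB gxy subrr.
Qed.

Lemma rV_inj_leq m n (c : {linear 'rV[K]_m -> 'rV[K]_n}) :
  injective c -> (m <= n)%N.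
Proof.
move=> cinj; have : row_free (lin1_mx c).
  rewrite -kermx_eq0; apply/eqP/row_matrixP => i; apply: cinj.
  rewrite row0 linear0 -mul_rV_lin1.
  by have /sub_kermxP := row_sub i (kermx (lin1_mx c)).
by rewrite /row_free => /eqP <-; exact: rank_leq_col.
Qed.

Lemma findim_inj_leq m (V : lmodType K) (c : {linear 'rV[K]_m -> V}) :
  findim V -> injective c -> (m <= dimension V)%N.
Proof.
move=> [n [g gbij]] cinj; rewrite (dimensionE gbij).
have [h gK hK] := gbij.
have lin : linear (h \o c).
  by move=> a x y; apply: (can_inj gK); rewrite /= hK !linearP /= !hK.
pose L := GRing.isLinear.Build _ _ _ _ _ lin.
pose e : {linear 'rV[K]_m -> 'rV[K]_n} := HB.pack (h \o c) L.
by apply: (@rV_inj_leq _ _ e) => x y /= /(can_inj hK) /cinj.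
Qed.

Definition comb n (V : lmodType K) (v : 'I_n -> V) (x : 'rV[K]_n) : V :=
  \sum_i x 0 i *: v i.

Fact comb_linear n (V : lmodType K) (v : 'I_n -> V) : linear (comb v).
Proof.
move=> a x y; rewrite /comb scaler_sumr -big_split /=; apply: eq_bigr => i _.
by rewrite !mxE scalerDl scalerA.
Qed.

HB.instance Definition _ n (V : lmodType K) (v : 'I_n -> V) :=
  GRing.isLinear.Build K 'rV[K]_n V *:%R (comb v) (@comb_linear n V v).

Lemma combE n (V : lmodType K) (g : {linear 'rV[K]_n -> V}) x :
  g x = comb (fun i => g (delta_mx 0 i)) x.
Proof.
rewrite {1}(row_sum_delta x) linear_sum; apply: eq_bigr => i _.
by rewrite linearZ.
Qed.

(** An injective linear map out of ['rV[K]_m] plays the role of m independent vectors; this map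
    concatenates two such families. *)
Definition rV_add m n (V : lmodType K) (g : {linear 'rV[K]_m -> V})
    (h : {linear 'rV[K]_n -> V}) : {linear 'rV[K]_(m + n) -> V} :=
  (g \o lsubmx) \+ (h \o rsubmx).

(* An injective map of maximal rank is onto: a vector outside its image would
   extend it. *)
Lemma findim_bounded N (V : lmodType K) :
  (forall m (c : {linear 'rV[K]_m -> V}), injective c -> (m <= N)%N) ->
  findim V.
Proof.
move=> bnd.
pose P m := `[< exists c : {linear 'rV[K]_m -> V}, injective c >].
have exP : exists m, P m.
  by exists 0%N; apply/asboolP; exists \0 => x y _; rewrite !thinmx0.
have ubP m : P m -> (m <= N)%N by move=> /asboolP[c /bnd].
case: (ex_maxnP exP ubP) => m /asboolP[c cinj] mmax.
exists m, c.
suff surj v : exists x, c x = v.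
  have [h hK] := choice surj.
  by exists h => // x; apply: cinj; rewrite hK.
apply: contrapT => nv; suff : (m.+1 <= m)%N by rewrite ltnn.
rewrite -addn1; apply: mmax; apply/asboolP.
exists (rV_add c (comb (fun _ : 'I_1 => v))); apply: linear_injective => x /=.
rewrite /comb big_ord1 => E.
have x0 : rsubmx x 0 0 = 0.
  apply/eqP/negPn/negP => xn0; apply: nv.
  exists (- (rsubmx x 0 0)^-1 *: lsubmx x).
  rewrite linearZ /= -[c _](addrK (rsubmx x 0 0 *: v)) E sub0r.
  by rewrite scalerN scaleNr opprK scalerA mulVf // scale1r.
move: E; rewrite x0 scale0r addr0 -(linear0 c) => /cinj xl.
rewrite -[x]hsubmxK xl; have -> : rsubmx x = 0; last exact: row_mx0.
by apply/matrixP => i j; rewrite !ord1 x0 mxE.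
Qed.

Lemma findim_inj (V W : lmodType K) (f : {linear V -> W}) :
  findim W -> injective f -> findim V.
Proof.
move=> fdW finj; apply: (@findim_bounded (dimension W)) => m c cinj.
by apply: (findim_inj_leq (c := f \o c) fdW) => x y /finj /cinj.
Qed.

Lemma findim_rV n : findim 'rV[K]_n.
Proof. by exists n, idfun; exists id. Qed.

Lemma findim_prod (V W : lmodType K) :
  findim V -> findim W -> findim (V * W)%type.
Proof.
move=> [m [g [g' gK g'K]]] [n [h [h' hK h'K]]].
have lin : linear (fun x : 'rV[K]_(m + n) => (g (lsubmx x), h (rsubmx x))).
  by move=> a x y; rewrite !linearP.
pose L := GRing.isLinear.Build _ _ _ _ _ lin.
pose e : {linear 'rV[K]_(m + n) -> (V * W)%type} :=
  HB.pack (fun x : 'rV[K]_(m + n) => (g (lsubmx x), h (rsubmx x))) L.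
exists (m + n)%N, e; exists (fun v => row_mx (g' v.1) (h' v.2)).
  by move=> x; rewrite /= gK hK hsubmxK.
by move=> [v w]; rewrite /= row_mxKl row_mxKr g'K h'K.
Qed.

Section LinearRelation.
Variables (V W : lmodType K) (R : V -> W -> Prop).

(** A linear subspace of V x W. Relations replace maps because passing from a vector of [Fbar] to
    the class it represents is only partially defined. If R is total onto W and [R 0 w] forces w =
    0, then R is a linear surjection from a subspace of V onto W. *)
Definition linear_rel := R 0 0 /\
  forall a x y v w, R x v -> R y w -> R (a *: x + y) (a *: v + w).

Hypothesis Rlin : linear_rel.
Hypothesis Rtot : forall w, exists v, R v w.

(** Preimages are chosen for the basis vectors only and extended linearly, which R respects. *)
Lemma linear_rel_lift n (g : {linear 'rV[K]_n -> W}) :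
  exists s : {linear 'rV[K]_n -> V}, forall x, R (s x) (g x).
Proof.
have [v vR] := choice (fun i => Rtot (g (delta_mx 0 i))).
exists (comb v) => x; rewrite (combE g) /= /comb.
apply: (big_ind2 R) => [|y y' z z' Ry Rz|i _]; first exact: Rlin.1.
  by rewrite -[y]scale1r -[y']scale1r; apply: Rlin.2.
have := Rlin.2 (x 0 i) _ _ _ _ (vR i) Rlin.1.
by rewrite !addr0.
Qed.

Hypothesis R0 : forall w, R 0 w -> w = 0.

(** Any independent family in W lifts through R to one in V, so [findim V] bounds its size and W is
    finite-dimensional; then a basis of W is lifted. *)
Lemma linear_rel_section : findim V ->
  exists s : {linear 'rV[K]_(dimension W) -> V},
    exists g : {linear 'rV[K]_(dimension W) -> W},
    injective g /\ forall x, R (s x) (g x).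
Proof.
move=> fdV; have [n [g gbij]] : findim W.
  apply: (@findim_bounded (dimension V)) => m c cinj.
  have [s sR] := linear_rel_lift c.
  apply: (findim_inj_leq (c := s) fdV); apply: linear_injective => x sx.
  by apply: cinj; rewrite linear0; apply: R0; rewrite -sx.
rewrite (dimensionE gbij); have [s sR] := linear_rel_lift g.
by exists s, g; split=> //; exact: bij_inj.
Qed.

End LinearRelation.

(** R separates the two families: it relates the values of i to 0 and those of s to the independent
    family g. If a sum [s x + i y] vanishes, then 0 is related to [g x], so x = 0, and then y =
    0. *)
Lemma rV_add_inj k m (V W : lmodType K) (R : V -> W -> Prop)
    (i : {linear 'rV[K]_k -> V}) (s : {linear 'rV[K]_m -> V})
    (g : {linear 'rV[K]_m -> W}) :
  linear_rel R -> (forall w, R 0 w -> w = 0) -> (forall x, R (i x) 0) ->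
  (forall x, R (s x) (g x)) -> injective i -> injective g ->
  injective (rV_add s i).
Proof.
move=> Rlin R0 Ri Rs iinj ginj; apply: linear_injective => x /= E.
have sx0 : lsubmx x = 0.
  apply: ginj; rewrite linear0; apply: R0; rewrite -E.
  by have := Rlin.2 1 _ _ _ _ (Rs (lsubmx x)) (Ri (rsubmx x)); rewrite !scale1r addr0.
have ix0 : rsubmx x = 0.
  by apply: iinj; move: E; rewrite sx0 !linear0 add0r.
by rewrite -[x]hsubmxK sx0 ix0 row_mx0.
Qed.

End FiniteDimension.

(** * Consequences of freeness for structure maps and gluing *)

Section FreeModules.
Variable K : fieldType.

(** These are the properties of finitely generated free modules that the argument relies on. The
    last one is exactness of M_p0 -> M_p1 + M_p2 -> M_p in the middle, which makes M_<p a subspace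
    of M_p. *)
Definition tame (M : pmod K) : Prop :=
  [/\ forall z, findim (M z),
      forall u v (uv : (u <= v)%O), injective (pm_map M uv) &
      forall p x y, unglue ((x, y) : M (grade1 p) * M (grade2 p)) = 0 ->
        exists t, glue t = (x, y)].

Lemma tame_iso (M N : pmod K) : pisomorphic M N -> tame N -> tame M.
Proof.
move=> [f [g [fK gK]]] [Nfd Ninj Nglue]; split.
- by move=> z; apply: (findim_inj (Nfd z)) (can_inj (fK z)).
- move=> u v uv x y E; apply: (can_inj (fK u)).
  by apply: (Ninj u v uv); rewrite -!ph_nat E.
- move=> p x y E; have [|t] := Nglue p (f _ x) (f _ y).
    move: E; rewrite /unglue /= -!ph_nat -linearD => ->; exact: linear0.
  move=> [tx ty]; exists (g _ t); rewrite /glue -!ph_nat -[- _]linearN.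
  by rewrite tx ty !fK.
Qed.

(** Every space has dimension 0 or 1, so gluing reduces to four cases, according to whether u lies
    below p1 and below p2. *)
Lemma tame_E u : tame (E_mod K u).
Proof.
split=> [z|v w vw|p x y].
- exact: findim_rV.
- apply: linear_injective; rewrite /= /E_space.
  have := fun h => le_trans (h : (u <= v)%O) vw.
  case: (u <= v)%O => [->//|_ x _]; last by rewrite thinmx0.
  move=> x /matrixP E; apply/matrixP => i j.
  by have := E i j; rewrite !mxE big_ord1 !mxE mulr1 !ord1.
rewrite /unglue /glue /= /E_space in x y *.
(* p0 is the meet of p1 and p2. *)
have E0 : (u <= grade0 p)%O = (u <= grade1 p)%O && (u <= grade2 p)%O.
  by rewrite le_grade0E le_grade1E le_grade2E; lia.
(* The dimensions are about to become independent booleans; these two implications retain what the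
   order says about them. *)
have := fun h => le_trans (h : (u <= grade1 p)%O) (le_grade1 p).
have := fun h => le_trans (h : (u <= grade2 p)%O) (le_grade2 p).
rewrite E0; move: (u <= p)%O => b.
case: (u <= grade1 p)%O x => x; case: (u <= grade2 p)%O y => y /= b2 b1 /matrixP E.
(* All spaces are lines and the hypothesis reads x + y = 0, so x itself glues to (x, -x). In the
   other cases the space at p0 is zero and both x and y vanish. *)
- exists x; have := E 0; rewrite b1 // => /(_ 0); rewrite !mxE !big_ord1 !mxE !mulr1 => E'.
  congr pair; apply/matrixP => i j; rewrite !mxE big_ord1 !mxE mulr1 !ord1 //.
  by apply/eqP; rewrite eq_sym -addr_eq0 addrC E'.
- exists 0; rewrite b1 // in E; have := E 0 0.
  rewrite !mxE big_ord1 big_ord0 !mxE mulr1 addr0 => E'.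
  congr pair; last by rewrite !thinmx0.
  by rewrite mul0mx; apply/matrixP => i j; rewrite !ord1 mxE E'.
- exists 0; rewrite b2 // in E; have := E 0 0.
  rewrite !mxE big_ord1 big_ord0 !mxE mulr1 add0r => E'.
  congr pair; first by rewrite !thinmx0.
  by rewrite mul0mx oppr0; apply/matrixP => i j; rewrite !ord1 mxE E'.
- by exists 0; rewrite !thinmx0.
Qed.

Lemma tame_psum (M N : pmod K) : tame M -> tame N -> tame (psum M N).
Proof.
move=> [Mfd Minj Mglue] [Nfd Ninj Nglue]; split.
- by move=> z; apply: findim_prod.
- by move=> u v uv [x y] [x' y'] [/Minj -> /Ninj ->].
- move=> p [x x'] [y y'] [/Mglue[t [tx ty]] /Nglue[t' [tx' ty']]].
  exists (t, t'); congr pair; [exact: congr2 tx tx'|].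
  exact: congr2 ty ty'.
Qed.

Lemma fg_free_tame (M : pmod K) : fg_free M -> tame M.
Proof.
move=> [s /tame_iso]; apply; elim: s => [|u s IH] /=.
  split=> [z|u v uv x y|p x y _]; first exact: findim_rV.
    by rewrite !thinmx0.
  by exists 0; rewrite !thinmx0 /glue /= oppr0.
by apply: tame_psum => //; exact: tame_E.
Qed.

Lemma tame_glue_inj (M : pmod K) p : tame M -> injective (@glue K M p).
Proof. by move=> [_ Minj _] x y [/Minj]. Qed.

Lemma tame_below_incl_inj (M : pmod K) p : tame M -> injective (below_incl M p).
Proof.
move=> [_ _ Mglue]; apply: linear_injective => q.
have [[x y] <-] := coker_pi_surj q; rewrite below_inclE => /Mglue[t tE].
by rewrite -(linear0 (coker_pi (@glue K M p))); apply/coker_eq; exists t; rewrite subr0.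
Qed.

End FreeModules.

(** * Acyclic mapping cones *)

Section ConeAcyclic.
Variable K : fieldType.

(* Acyclicity of the mapping cone of [f], whose degree n part is
   [D n * C n.-1]. *)
Definition cone_acyclic (C D : vcomplex K) (f : vchain C D) : Prop :=
  (forall y, exists x v, y = f 0 x + vc_d D 0 v) /\
  forall n x y, vc_bd C n x = 0 -> f n x = vc_d D n y ->
    exists x' y', x = vc_d C n x' /\ y = f n.+1 x' + vc_d D n.+1 y'.

Lemma coker_pi_eq0 (V W : lmodType K) (g : {linear V -> W}) y :
  coker_pi g y = 0 <-> exists x, g x = y.
Proof. by rewrite -(linear0 (coker_pi g)) coker_eq subr0. Qed.

Lemma vH_class_eq0 (C : vcomplex K) n (x : vc_cycles C n) :
  coker_pi (vc_boundary C n) x = 0 <-> exists u, vc_d C n u = \val x.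
Proof.
rewrite coker_pi_eq0; split=> -[u ux]; exists u; first by rewrite -ux.
exact: val_inj.
Qed.

Lemma cycle_of (C : vcomplex K) n x :
  vc_bd C n x = 0 -> {z : vc_cycles C n | \val z = x}.
Proof.
move=> x0; have xk : x \in ker_pred (vc_bd C n) by rewrite inE x0.
by exists (Ker xk).
Qed.

Section Chain.
Variables (C D : vcomplex K) (f : vchain C D).

(** Injectivity on homology gives x = d u. Then y - f u is a cycle, and surjectivity one degree
    higher writes it as f x' + d v with x' a cycle, so u + x' and v are the required pair. *)
Lemma vH_bij_cone_acyclic : (forall n, bijective (vH_map f n)) -> cone_acyclic f.
Proof.
move=> fbij.
have inj n x v : vc_bd C n x = 0 -> f n x = vc_d D n v ->
    exists u, x = vc_d C n u.
  move=> /cycle_of[z <-] fz.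
  have : coker_pi (vc_boundary C n) z = 0.
    apply: (bij_inj (fbij n)); rewrite linear0 vH_mapE.
    by apply/vH_class_eq0; exists v.
  by move=> /vH_class_eq0[u <-]; exists u.
have surj n y : vc_bd D n y = 0 -> exists x v, vc_bd C n x = 0 /\
    y = f n x + vc_d D n v.
  move=> /cycle_of[z <-]; have [h _ hK] := fbij n.
  have [x xE] := coker_pi_surj (h (coker_pi (vc_boundary D n) z)).
  have := hK (coker_pi (vc_boundary D n) z).
  rewrite -xE vH_mapE => /esym/coker_eq[v vE].
  exists (\val x), v; split; first exact: ker_valE.
  have -> : vc_d D n v = \val (vc_boundary D n v) by [].
  by rewrite vE [in RHS]/= addrC subrK.
split=> [y|n x y x0 fx].
  by have [|x [v [_ ->]]] := surj 0%N y => //; exists x, v.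
have [u xu] := inj n x y x0 fx.
have [|x' [v [x'0 yE]]] := surj n.+1 (y - f n.+1 u).
  by rewrite /= linearB /= -vch_comm -xu fx subrr.
exists (u + x'), v; split; first by rewrite linearD /= x'0 addr0.
by rewrite linearD -addrA -yE addrC subrK.
Qed.

Hypothesis facyc : cone_acyclic f.

Lemma cone_acyclic_surj n y : vc_bd D n y = 0 ->
  exists x v, vc_bd C n x = 0 /\ y = f n x + vc_d D n v.
Proof.
case: n y => [|n] y y0; first by have [x [v ->]] := facyc.1 y; exists x, v.
have [||x [v [x0 ->]]] := facyc.2 n 0 y; rewrite ?linear0 //.
by exists x, v; split.
Qed.

Lemma cone_acyclic_inj n x v : vc_bd C n x = 0 -> f n x = vc_d D n v ->
  exists u, x = vc_d C n u.
Proof. by move=> x0 fx; have [u [_ [xu _]]] := facyc.2 n x v x0 fx; exists u. Qed.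

End Chain.

(** * The dimension bound for a square of complexes *)

Section DeltaBound.
Variables (A B A' B' : vcomplex K).
Variables (a : vchain A B) (i : vchain A' B').
Variables (f : vchain A A') (g : vchain B B').
Hypothesis comm : forall n x, g n (a n x) = i n (f n x).
Hypothesis facyc : cone_acyclic f.
Hypothesis gacyc : cone_acyclic g.
Hypothesis iinj : forall n, injective (i n).

(** y represents c through g, up to boundaries and up to vectors coming from A'; allowing the latter
    is what makes the lifts independent of the image of i. *)
Definition coker_rel n (y : B' n) (c : coker (vH_map a n)) : Prop :=
  exists (x : vc_cycles B n) w v,
    coker_pi _ (coker_pi (vc_boundary B n) x) = c /\
    y = g n (\val x) + i n w + vc_d B' n v.

Lemma coker_rel_linear n : linear_rel (@coker_rel n).
Proof.
split; first by exists 0, 0, 0; rewrite !linear0 !addr0.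
move=> k _ _ _ _ [x [w [v [<- ->]]]] [x' [w' [v' [<- ->]]]].
exists (k *: x + x'), (k *: w + w'), (k *: v + v'); split.
  by rewrite (linearP (coker_pi _)) (linearP (coker_pi _)).
rewrite (linearP \val) (linearP (g n)) (linearP (i n)) (linearP (vc_d B' n)).
by rewrite !scalerDr addrACA; congr (_ + _); rewrite addrACA.
Qed.

Lemma coker_rel_total n c : exists y, @coker_rel n y c.
Proof.
have [q <-] := coker_pi_surj c; have [x <-] := coker_pi_surj q.
by exists (g n (\val x)), x, 0, 0; rewrite !linear0 !addr0.
Qed.

Lemma coker_rel_below n w : @coker_rel n (i n w) 0.
Proof. by exists 0, w, 0; rewrite !linear0 add0r addr0. Qed.

(** From 0 = g x + i w + d v, injectivity of i makes w a cycle, so w = f u + d v' with u a cycle.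
    Then g (x + a u) = - d (i v' + v) is a boundary, hence so is x + a u, and the class of x is the
    image of minus the class of u. *)
Lemma coker_rel0 n c : @coker_rel n 0 c -> c = 0.
Proof.
move=> [x [w [v [<- E]]]].
have w0 : vc_bd A' n w = 0.
  case: n x w v {c} E => [|n] x w v E //; apply: iinj.
  have /= x0 := ker_valE x.
  move/(congr1 (vc_d B' n)): E; rewrite !linearD /= linear0 vc_dd addr0.
  by rewrite -!vch_comm x0 !linear0 add0r.
have [u [v' [u0 wE]]] := cone_acyclic_surj facyc w0.
have [z zE] := cycle_of u0.
have xz0 : vc_bd B n (\val x + a n u) = 0.
  rewrite linearD /= ker_valE add0r -zE.
  exact: (ker_valE (vcycles_map a n z)).
have [|t tE] := cone_acyclic_inj gacyc (v := - (i n.+1 v' + v)) xz0.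
  rewrite linearD /= comm linearN linearD /= -vch_comm; apply/eqP.
  by rewrite -addr_eq0 -!addrA [i n _ + (_ + _)]addrA -linearD -wE addrA -E.
apply/coker_pi_eq0; exists (- coker_pi _ z).
rewrite linearN vH_mapE; apply/eqP; rewrite eq_sym -addr_eq0 -linearD; apply/eqP.
by apply/vH_class_eq0; exists t; rewrite /= -tE zE.
Qed.

(** A class of A killed in B becomes, after f, a boundary in B'; y is a chain bounding it there, up
    to boundaries of A'. *)
Definition ker_rel n (y : B' n.+1) (q : ker (vH_map a n)) : Prop :=
  exists (x : vc_cycles A n) w,
    coker_pi (vc_boundary A n) x = \val q /\
    vc_d B' n y = i n (f n (\val x) + vc_d A' n w).

Lemma ker_rel_linear n : linear_rel (@ker_rel n).
Proof.
split; first by exists 0, 0; rewrite !(linear0, addr0).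
move=> k y y' q q' [x [w [xq yx]]] [x' [w' [xq' yx']]].
exists (k *: x + x'), (k *: w + w'); rewrite !linearP /= xq xq' yx yx'; split=> //.
by rewrite -linearP scalerDr addrACA.
Qed.

Lemma ker_rel_total n q : exists y, @ker_rel n y q.
Proof.
have [x xq] := coker_pi_surj (\val q); have := ker_valE q.
rewrite -xq vH_mapE => /vH_class_eq0[u uE].
exists (g n.+1 u), x, 0; split=> //.
by rewrite -vch_comm uE linear0 addr0 /= comm.
Qed.

Lemma ker_rel0 n q : @ker_rel n 0 q -> q = 0.
Proof.
move=> [x [w [xq]]]; rewrite linear0 -(linear0 (i n)) => /iinj/esym/eqP.
rewrite addr_eq0 -linearN => /eqP fx.
have [u xu] := cone_acyclic_inj facyc (ker_valE x) fx.
by apply: val_inj; rewrite -xq; apply/vH_class_eq0; exists u.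
Qed.

(** For y = g x + i w + d v with x a cycle, d y = i (d w) has trivial class. Hence [ker_rel]
    separates the kernel lifts from the cokernel lifts and from the image of i. *)
Lemma coker_rel_ker_rel n y c : @coker_rel n.+1 y c -> ker_rel y 0.
Proof.
move=> [x [w [v [_ ->]]]]; exists 0, w; split; first by rewrite !linear0.
rewrite !linearD /= vc_dd addr0 -!vch_comm !linear0.
by have /= -> := ker_valE x; rewrite linear0.
Qed.

(** Three independent families of [B' n] are concatenated: the image under i of a basis of [A' n],
    lifts of a basis of the cokernel, independent of the first by [coker_rel], and in positive
    degree lifts of a basis of the kernel, independent of both by [ker_rel]. *)
Lemma dim_ker_coker_below n : findim (B' n) ->
  ((if n is m.+1 then dimension (ker (vH_map a m)) else 0)
   + dimension (coker (vH_map a n)) + dimension (A' n) <= dimension (B' n))%N.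
Proof.
move=> fdB'; have [k [b bbij]] := findim_inj fdB' (iinj (n := n)).
rewrite (dimensionE bbij) -addnA.
have ibinj : injective (i n \o b : {linear _ -> _}).
  by apply: inj_comp (iinj (n := n)) (bij_inj bbij).
have [s [h [hinj sR]]] :=
  linear_rel_section (@coker_rel_linear n) (@coker_rel_total n) (@coker_rel0 n) fdB'.
have jinj := rV_add_inj (i := i n \o b) (@coker_rel_linear n) (@coker_rel0 n)
  (fun x => coker_rel_below (b x)) sR ibinj hinj.
case: n => [|n] in fdB' k b bbij ibinj s h hinj sR jinj *.
  by rewrite add0n; exact: findim_inj_leq fdB' jinj.
have [s' [h' [hinj' sR']]] :=
  linear_rel_section (@ker_rel_linear n) (@ker_rel_total n) (@ker_rel0 n) fdB'.
apply: (findim_inj_leq fdB').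
apply: rV_add_inj (@ker_rel_linear n) (@ker_rel0 n) _ sR' jinj hinj' => x.
apply: coker_rel_ker_rel.
have := (@coker_rel_linear n.+1).2 1 _ _ _ _ (sR (lsubmx x))
  (coker_rel_below (b (rsubmx x))).
by rewrite scale1r; apply.
Qed.

End DeltaBound.
End ConeAcyclic.

(** * Acyclic cones in a map of short exact sequences *)

Section ShortExact.
Variable K : fieldType.
Variables (A B C A' B' C' : vcomplex K).
Variables (i : vchain A B) (q : vchain B C) (i' : vchain A' B') (q' : vchain B' C').
Variables (f : vchain A A') (g : vchain B B') (h : vchain C C').
Hypothesis gi : forall n x, g n (i n x) = i' n (f n x).
Hypothesis hq : forall n x, h n (q n x) = q' n (g n x).
Hypothesis iinj : forall n, injective (i n).
Hypothesis iinj' : forall n, injective (i' n).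
Hypothesis qi : forall n x, q n x = 0 <-> exists a, i n a = x.
Hypothesis qi' : forall n x, q' n x = 0 <-> exists a, i' n a = x.
Hypothesis qsurj : forall n y, exists x, q n x = y.
Hypothesis qsurj' : forall n y, exists x, q' n x = y.

(** The three cones form a short exact sequence, so the third is acyclic when the first two are; the
    proof is the corresponding diagram chase. *)
Lemma cone_acyclic_ses : cone_acyclic f -> cone_acyclic g -> cone_acyclic h.
Proof.
move=> facyc gacyc; split=> [z|n x y].
  have [y <-] := qsurj' z; have [x [v ->]] := gacyc.1 y.
  by exists (q _ x), (q' _ v); rewrite linearD /= vch_comm hq.
have [{}x <-] := qsurj x; have [{}y <-] := qsurj' y => qx0 hx.
(* The lifts x and y satisfy the cone equation only up to an error t in A'. *)
have [t tE] : exists t, i' n t = g n x - vc_d B' n y.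
  by apply/qi'; rewrite linearB /= -hq hx vch_comm subrr.
(* Acyclicity for f absorbs the error: replacing x by x - i s and y by y + i' u gives an honest
   cycle of the cone of g. In positive degree, d x = i r, and (r, t) is a cycle of the cone of f. *)
have [s [u [tsu xs0]]] : exists s u, t = f n s + vc_d A' n u /\
    vc_bd B n (x - i n s) = 0.
  case: n x y qx0 {hx} t tE => [|n] x y qx0 t tE.
    by have [s [u ->]] := facyc.1 t; exists s, u.
  move: qx0; rewrite /= -vch_comm => /qi[r rE].
  have r0 : vc_bd A n r = 0.
    case: n x r {y t tE} rE => [//|n] x r rE; apply: iinj.
    by rewrite /= vch_comm rE vc_dd linear0.
  have rt : f n r = vc_d A' n t.
    by apply: iinj'; rewrite vch_comm tE -gi rE vch_comm linearB /= vc_dd subr0.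
  have [s [u [rs tu]]] := facyc.2 n r t r0 rt.
  by exists s, u; rewrite linearB /= -vch_comm -rs rE subrr.
have [||s' [u' [xE yE]]] := gacyc.2 n (x - i n s) (y + i' _ u) => //.
  rewrite linearB linearD /= gi -vch_comm; apply/eqP.
  rewrite subr_eq -addrA -linearD [vc_d A' _ _ + _]addrC -tsu tE addrC.
  by rewrite subrK.
have qi0 m a : q m (i m a) = 0 by apply/qi; exists a.
have qi0' m a : q' m (i' m a) = 0 by apply/qi'; exists a.
exists (q _ s'), (q' _ u'); split.
  by rewrite -vch_comm -xE linearB /= qi0 subr0.
by rewrite hq -vch_comm -linearD -yE linearD /= qi0' addr0.
Qed.

End ShortExact.

(** * Passage to the complexes below a grade *)

Section Below.
Variable K : fieldType.

Section PairComplex.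
Variables (C D : vcomplex K).

Fact pair_complex_dd n (x : C n.+2 * D n.+2) :
  pair_map (vc_d C n) (vc_d D n) (pair_map (vc_d C n.+1) (vc_d D n.+1) x) = 0.
Proof. by rewrite /pair_map /= !vc_dd. Qed.

Definition pair_complex : vcomplex K :=
  @VComplex K (fun n => (C n * D n)%type) (fun n => pair_map (vc_d C n) (vc_d D n))
    pair_complex_dd.

Lemma pair_bd n x : vc_bd pair_complex n x = 0 ->
  vc_bd C n x.1 = 0 /\ vc_bd D n x.2 = 0.
Proof. by case: n x => [|n] [x y] //= [-> ->]. Qed.

End PairComplex.

Section PairChain.
Variables (C D C' D' : vcomplex K) (f : vchain C C') (g : vchain D D').

Fact pair_chain_comm n (x : pair_complex C D n.+1) :
  pair_map (f n) (g n) (vc_d (pair_complex C D) n x)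
    = vc_d (pair_complex C' D') n (pair_map (f n.+1) (g n.+1) x).
Proof. by rewrite /= /pair_map /= !vch_comm. Qed.

Definition pair_chain : vchain (pair_complex C D) (pair_complex C' D') :=
  @VChain K (pair_complex C D) (pair_complex C' D')
    (fun n => pair_map (f n) (g n)) pair_chain_comm.

Lemma pair_cone_acyclic :
  cone_acyclic f -> cone_acyclic g -> cone_acyclic pair_chain.
Proof.
move=> facyc gacyc; split=> [[y y']|n [x x'] [y y'] /pair_bd[/= x0 x0'] [fx gx]].
  have [x [v ->]] := facyc.1 y; have [x' [v' ->]] := gacyc.1 y'.
  by exists (x, x'), (v, v').
have [u [v [-> ->]]] := facyc.2 n x y x0 fx.
have [u' [v' [-> ->]]] := gacyc.2 n x' y' x0' gx.
by exists (u, u'), (v, v').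
Qed.

End PairChain.

Section Glue.
Variables (C : pcomplex K) (p : grade).

Fact glue_chain_comm n (x : C n.+1 (grade0 p)) :
  glue (pc_d C n _ x) = pair_map (pc_d C n _) (pc_d C n _) (glue x).
Proof. by rewrite /glue /pair_map /= linearN !ph_nat. Qed.

Definition glue_chain :
    vchain (pc_at C (grade0 p)) (pair_complex (pc_at C (grade1 p)) (pc_at C (grade2 p))) :=
  @VChain K (pc_at C (grade0 p)) (pair_complex (pc_at C (grade1 p)) (pc_at C (grade2 p)))
    (fun n => @glue K (C n) p) glue_chain_comm.

Fact below_pi_comm n (x : C n.+1 (grade1 p) * C n.+1 (grade2 p)) :
  coker_pi (@glue K (C n) p) (pair_map (pc_d C n _) (pc_d C n _) x)
   = below_map (pc_d C n) p (coker_pi (@glue K (C n.+1) p) x).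
Proof. by rewrite below_mapE. Qed.

Definition below_pi :
    vchain (pair_complex (pc_at C (grade1 p)) (pc_at C (grade2 p))) (pc_below C p) :=
  @VChain K (pair_complex (pc_at C (grade1 p)) (pc_at C (grade2 p))) (pc_below C p)
    (fun n => coker_pi (@glue K (C n) p)) below_pi_comm.

End Glue.

Variables (F G : pcomplex K) (f : pchain F G) (p : grade).

Fact below_chain_comm n (q : below (F n.+1) p) :
  below_map (f n) p (below_map (pc_d F n) p q)
    = below_map (pc_d G n) p (below_map (f n.+1) p q).
Proof.
have [[x y] <-] := coker_pi_surj q.
by rewrite !below_mapE /pair_map /= !pch_comm.
Qed.

Definition below_chain : vchain (pc_below F p) (pc_below G p) :=
  @VChain K (pc_below F p) (pc_below G p) (fun n => below_map (f n) p) below_chain_comm.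

(** The rows are 0 -> F_p0 -> F_p1 + F_p2 -> F_<p -> 0 and its analogue for G; tameness supplies
    injectivity on the left. *)
Lemma below_cone_acyclic :
  (forall n, tame (F n)) -> (forall n, tame (G n)) ->
  (forall z, cone_acyclic (pch_at f z)) -> cone_acyclic below_chain.
Proof.
move=> Ftame Gtame facyc.
apply: (@cone_acyclic_ses K _ _ _ _ _ _ (glue_chain F p) (below_pi F p)
  (glue_chain G p) (below_pi G p) (pch_at f (grade0 p))
  (pair_chain (pch_at f (grade1 p)) (pch_at f (grade2 p)))).
- by move=> n x; rewrite /= /pair_map /glue /= linearN !ph_nat.
- by move=> n x; exact: below_mapE.
- by move=> n; apply: tame_glue_inj.
- by move=> n; apply: tame_glue_inj.
- by move=> n x; apply: coker_pi_eq0.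
- by move=> n x; apply: coker_pi_eq0.
- by move=> n; apply: coker_pi_surj.
- by move=> n; apply: coker_pi_surj.
- exact: facyc.
- exact: pair_cone_acyclic.
Qed.

End Below.

Theorem theorem3p6 (F Fbar : pcomplex 'F_2)
    (F_free : forall n : nat, fg_free (F n))
    (Fbar_free : forall n : nat, fg_free (Fbar n))
    (qis : quasi_isomorphic F Fbar)
    (n : nat) (p : grade) :
  (delta n p F)%:Z <= gamma n p Fbar.
Proof.
have Ftame m : tame (F m) by apply: fg_free_tame.
have Gtame m : tame (Fbar m) by apply: fg_free_tame.
have [f fiso] := qis.
have facyc z : cone_acyclic (pch_at f z).
  apply: vH_bij_cone_acyclic => m; have [g [fK gK]] := fiso m.
  by exists (g z) => x; [exact: fK|exact: gK].
(* Once the subtracted dimension is moved to the left, the integer inequality is by computation one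
   between naturals. The square has F_<p -> F_p on top and its analogue for [Fbar] below. *)
rewrite /gamma lerBrDr; apply: (@dim_ker_coker_below _ _ _ _ _
  (pc_below_incl F p) (pc_below_incl Fbar p) (below_chain f p) (pch_at f p)).
- by move=> m x; apply/esym/below_incl_nat.
- exact: below_cone_acyclic.
- exact: facyc.
- by move=> m; apply: tame_below_incl_inj.
- by have [fd _ _] := Gtame n; exact: fd.
Qed.
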